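(* For every integer $n\ge 1$, $$e\left(\frac{n}{e}\right)^n\le n!\le e\sqrt{n}\left(\frac{n}{e}\right)^n$$ and $$1-\frac{\log(2\pi n)}{2}\le r_n\le 1-\frac{\log(2\pi)}{2}.$$ In each of these four inequalities, equality holds if and only if $n=1$.
   Context: The sequence $(r_n)_{n\ge 1}$ (the remainder in Stirling's formula) is defined by $n!=\sqrt{2\pi n}\,(n/e)^n e^{r_n}$. *)

(* Defs.v *)
From Stdlib Require Import Reals Factorial Lra Lia.
Open Scope R_scope.

(* The defining equation does not involve r 0, which is left arbitrary. *)
Definition stirling_remainder (r : nat -> R) : Prop :=
  forall n : nat, (1 <= n)%nat ->
    INR (fact n) = sqrt (2 * PI * INR n) * (INR n / exp 1) ^ n * exp (r n).

Lemma stirling_main_term_pos (n : nat) :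
  (1 <= n)%nat -> 0 < sqrt (2 * PI * INR n) * (INR n / exp 1) ^ n.
Proof.
  intros Hn.
  assert (Hn' : 0 < INR n) by (apply lt_0_INR; lia).
  pose proof PI_RGT_0 as Hpi. pose proof (exp_pos 1) as He.
  apply Rmult_lt_0_compat.
  - apply sqrt_lt_R0. apply Rmult_lt_0_compat; lra.
  - apply pow_lt. apply Rdiv_lt_0_compat; assumption.
Qed.

Lemma stirling_remainder_exists : exists r, stirling_remainder r.
Proof.
  exists (fun n => ln (INR (fact n) / (sqrt (2 * PI * INR n) * (INR n / exp 1) ^ n))).
  intros n Hn. pose proof (stirling_main_term_pos n Hn) as Hpos.
  set (D := sqrt (2 * PI * INR n) * (INR n / exp 1) ^ n) in *.
  rewrite exp_ln.
  - field. lra.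
  - apply Rdiv_lt_0_compat; [apply INR_fact_lt_0 | exact Hpos].
Qed.

Lemma stirling_remainder_unique (r r' : nat -> R) :
  stirling_remainder r -> stirling_remainder r' ->
  forall n : nat, (1 <= n)%nat -> r n = r' n.
Proof.
  intros Hr Hr' n Hn. pose proof (stirling_main_term_pos n Hn) as Hpos.
  apply exp_inv. apply Rmult_eq_reg_l
    with (r := sqrt (2 * PI * INR n) * (INR n / exp 1) ^ n); [|lra].
  rewrite <- Hr, <- Hr' by assumption. reflexivity.
Qed.

(* Main.v *)
Require Import Defs.
From Stdlib Require Import Reals Factorial Lra Lia.
From Coquelicot Require Import Coquelicot.
Open Scope R_scope.

(** Put [d n = ln n! - (1 + n ln n - n)], so that [n! = e (n/e)^n exp (d n)].
    All four inequalities are statements about this one sequence: the lower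
    bounds for [n!] and for [r n] both say [0 <= d n], and the upper bounds both
    say [d n <= ln n / 2], because taking logarithms in the definition of [r n]
    gives [r n = 1 - ln (2 PI n) / 2 + d n].

    Now [d] and [ln n / 2 - d] both vanish at [n = 1], and both increase
    strictly, with increments
    [1 - n ln (1 + 1/n)] and [(n + 1/2) ln (1 + 1/n) - 1].
    These are positive by the two classical bounds
    [2 x / (2 + x) < ln (1 + x) < x] at [x = 1/n].  Strict monotonicity
    gives the inequalities and the equality cases at once. *)

(** The left side is the [1/1] Padé approximant of [ln (1 + x)] at [0]. The
    difference vanishes at [0] and has derivative
    [x^2 / ((1 + x) (2 + x)^2)], which is positive for [x > 0]. *)
Lemma ln_1p_gt_pade (x : R) : 0 < x -> 2 * x / (2 + x) < ln (1 + x).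
Proof.
  intros Hx.
  destruct (MVT_cor2 (fun t => ln (1 + t) - 2 * t / (2 + t))
              (fun t => t ^ 2 / ((1 + t) * (2 + t) ^ 2)) 0 x Hx)
    as [c [Heq Hc]].
  - intros c Hc. apply is_derive_Reals. auto_derive.
    + repeat split; lra.
    + field. lra.
  - rewrite Rplus_0_r, ln_1 in Heq.
    assert (0 < c ^ 2 / ((1 + c) * (2 + c) ^ 2) * (x - 0)).
    { apply Rmult_lt_0_compat; [|lra].
      apply Rdiv_lt_0_compat; [|apply Rmult_lt_0_compat; [lra|]];
        apply pow_lt; lra. }
    lra.
Qed.

Lemma ln_1p_lt (x : R) : 0 < x -> ln (1 + x) < x.
Proof.
  intros Hx. rewrite <- (ln_exp x) at 2.
  apply ln_increasing; [lra | apply exp_ineq1; lra].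
Qed.

Lemma increasing_from_1_sign (u : nat -> R) :
  u 1%nat = 0 ->
  (forall n, (1 <= n)%nat -> u n < u (S n)) ->
  forall n, (1 <= n)%nat -> 0 <= u n /\ (u n = 0 <-> n = 1%nat).
Proof.
  intros H1 Hincr n Hn.
  assert (Hpos : forall k, 0 < u (S (S k))).
  { induction k as [|k IH].
    - rewrite <- H1. apply Hincr. lia.
    - eapply Rlt_trans; [exact IH | apply Hincr; lia]. }
  destruct n as [|[|k]]; [lia | |].
  - rewrite H1. split; [lra | tauto].
  - specialize (Hpos k). split; [lra|]. split; [lra | lia].
Qed.

Definition log_excess (n : nat) : R :=
  ln (INR (fact n)) - (1 + INR n * ln (INR n) - INR n).

Lemma fact_log_excess (n : nat) : (1 <= n)%nat ->
  INR (fact n) = exp 1 * (INR n / exp 1) ^ n * exp (log_excess n).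
Proof.
  intros Hn.
  assert (Hn' : 0 < INR n) by (apply lt_0_INR; lia).
  replace ((INR n / exp 1) ^ n) with (exp (INR n * (ln (INR n) - 1))).
  - rewrite <- !exp_plus. unfold log_excess.
    rewrite <- (exp_ln (INR (fact n))) at 1 by apply INR_fact_lt_0.
    f_equal. ring.
  - rewrite <- Rpower_pow by (apply Rdiv_lt_0_compat; [lra | apply exp_pos]).
    unfold Rpower. rewrite ln_div, ln_exp by (auto using exp_pos). reflexivity.
Qed.

Lemma log_excess_1 : log_excess 1 = 0.
Proof. unfold log_excess. simpl. rewrite ln_1. ring. Qed.

Lemma ln_INR_S (n : nat) : (1 <= n)%nat ->
  ln (INR (S n)) = ln (INR n) + ln (1 + / INR n).
Proof.
  intros Hn.
  assert (Hn' : 0 < INR n) by (apply lt_0_INR; lia).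
  pose proof (Rinv_0_lt_compat _ Hn').
  rewrite <- ln_mult by lra. rewrite S_INR. f_equal. field. lra.
Qed.

Lemma log_excess_S (n : nat) : (1 <= n)%nat ->
  log_excess (S n) = log_excess n + (1 - INR n * ln (1 + / INR n)).
Proof.
  intros Hn. unfold log_excess.
  change (fact (S n)) with (S n * fact n)%nat.
  rewrite mult_INR, ln_mult by (apply INR_fact_lt_0 || (apply lt_0_INR; lia)).
  rewrite ln_INR_S, S_INR by exact Hn. ring.
Qed.

Lemma log_excess_sign (n : nat) : (1 <= n)%nat ->
  0 <= log_excess n /\ (log_excess n = 0 <-> n = 1%nat).
Proof.
  revert n. apply increasing_from_1_sign; [exact log_excess_1|].
  intros n Hn. rewrite log_excess_S by exact Hn.
  assert (Hn' : 0 < INR n) by (apply lt_0_INR; lia).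
  pose proof (ln_1p_lt _ (Rinv_0_lt_compat _ Hn')) as Hlt.
  apply (Rmult_lt_compat_l (INR n)) in Hlt; [|lra].
  rewrite Rinv_r in Hlt by lra. lra.
Qed.

Lemma half_ln_sub_log_excess_sign (n : nat) : (1 <= n)%nat ->
  0 <= ln (INR n) / 2 - log_excess n /\
  (ln (INR n) / 2 - log_excess n = 0 <-> n = 1%nat).
Proof.
  revert n.
  apply (increasing_from_1_sign (fun n => ln (INR n) / 2 - log_excess n)).
  - rewrite log_excess_1. simpl. rewrite ln_1. field.
  - intros n Hn. rewrite log_excess_S, ln_INR_S by exact Hn.
    assert (Hn' : 0 < INR n) by (apply lt_0_INR; lia).
    pose proof (ln_1p_gt_pade _ (Rinv_0_lt_compat _ Hn')) as Hgt.
    apply (Rmult_lt_compat_l (INR n + / 2)) in Hgt; [|lra].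
    replace ((INR n + / 2) * (2 * / INR n / (2 + / INR n))) with 1 in Hgt
      by (field; lra).
    lra.
Qed.

Lemma stirling_remainder_log_excess (r : nat -> R) (n : nat) :
  stirling_remainder r -> (1 <= n)%nat ->
  r n = 1 - ln (2 * PI * INR n) / 2 + log_excess n.
Proof.
  intros Hr Hn.
  assert (Hn' : 0 < INR n) by (apply lt_0_INR; lia).
  pose proof PI_RGT_0 as Hpi.
  assert (Hpn : 0 < 2 * PI * INR n) by (apply Rmult_lt_0_compat; lra).
  assert (Hpow : 0 < (INR n / exp 1) ^ n)
    by (apply pow_lt, Rdiv_lt_0_compat; [lra | apply exp_pos]).
  pose proof (Hr n Hn) as Heq. rewrite fact_log_excess in Heq by exact Hn.
  apply exp_inv, Rmult_eq_reg_l
    with (r := sqrt (2 * PI * INR n) * (INR n / exp 1) ^ n).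
  - rewrite <- Heq.
    (* sqrt y * exp (- ln y / 2) = 1 cancels the factor sqrt (2 PI n). *)
    rewrite <- Rpower_sqrt by exact Hpn. unfold Rpower.
    replace (1 - ln (2 * PI * INR n) / 2 + log_excess n)
      with (- (/ 2 * ln (2 * PI * INR n)) + (1 + log_excess n)) by field.
    rewrite !exp_plus, exp_Ropp. field. apply Rgt_not_eq, exp_pos.
  - apply Rgt_not_eq, stirling_main_term_pos, Hn.
Qed.

(** With [M] a main term and [t = ln (n! / M)], this turns the sign of [t] into
    a comparison of [n!] with [M]. *)
Lemma mult_exp_compare (M t : R) : 0 < M ->
  (0 <= t -> M <= M * exp t) /\ (t <= 0 -> M * exp t <= M) /\
  (M * exp t = M <-> t = 0).
Proof.
  intros HM.
  assert (Hmono : forall a b, a <= b -> exp a <= exp b).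
  { intros a b [Hab | ->]; [left; apply exp_increasing, Hab | lra]. }
  repeat split; intros Ht.
  - rewrite <- (Rmult_1_r M) at 1. apply Rmult_le_compat_l; [lra|].
    rewrite <- exp_0. apply Hmono, Ht.
  - rewrite <- (Rmult_1_r M) at 2. apply Rmult_le_compat_l; [lra|].
    rewrite <- exp_0. apply Hmono, Ht.
  - apply exp_inv. rewrite exp_0. apply Rmult_eq_reg_l with M; lra.
  - rewrite Ht, exp_0. ring.
Qed.

Theorem corollary5 (r : nat -> R) (Hr : stirling_remainder r)
    (n : nat) (Hn : (1 <= n)%nat) :
  (exp 1 * (INR n / exp 1) ^ n <= INR (fact n) /\
   INR (fact n) <= exp 1 * sqrt (INR n) * (INR n / exp 1) ^ n /\
   1 - ln (2 * PI * INR n) / 2 <= r n /\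
   r n <= 1 - ln (2 * PI) / 2) /\
  ((exp 1 * (INR n / exp 1) ^ n = INR (fact n) <-> n = 1%nat) /\
   (INR (fact n) = exp 1 * sqrt (INR n) * (INR n / exp 1) ^ n <-> n = 1%nat) /\
   (1 - ln (2 * PI * INR n) / 2 = r n <-> n = 1%nat) /\
   (r n = 1 - ln (2 * PI) / 2 <-> n = 1%nat)).
Proof.
  assert (Hn' : 0 < INR n) by (apply lt_0_INR; lia).
  pose proof PI_RGT_0 as Hpi. pose proof (exp_pos 1) as He.
  assert (Hpow : 0 < (INR n / exp 1) ^ n)
    by (apply pow_lt, Rdiv_lt_0_compat; lra).
  pose proof (sqrt_lt_R0 _ Hn') as Hsqrt.
  destruct (log_excess_sign n Hn) as [Hlo Hlo1].
  destruct (half_ln_sub_log_excess_sign n Hn) as [Hup Hup1].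
  pose proof (stirling_remainder_log_excess r n Hr Hn) as Hrn.
  assert (Hln : ln (2 * PI * INR n) = ln (2 * PI) + ln (INR n))
    by (apply ln_mult; lra).
  pose proof (fact_log_excess n Hn) as Hfact.
  assert (Hfact' : INR (fact n) = exp 1 * sqrt (INR n) * (INR n / exp 1) ^ n
                     * exp (log_excess n - ln (INR n) / 2)).
  { rewrite Hfact, <- Rpower_sqrt by exact Hn'. unfold Rpower.
    replace (log_excess n - ln (INR n) / 2)
      with (- (/ 2 * ln (INR n)) + log_excess n) by field.
    rewrite exp_plus, exp_Ropp. field.
    apply Rgt_not_eq, exp_pos. }
  destruct (mult_exp_compare (exp 1 * (INR n / exp 1) ^ n) (log_excess n))
    as [Hle1 [_ Heq1]]; [apply Rmult_lt_0_compat; lra|].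
  destruct (mult_exp_compare (exp 1 * sqrt (INR n) * (INR n / exp 1) ^ n)
              (log_excess n - ln (INR n) / 2))
    as [_ [Hle2 Heq2]]; [repeat apply Rmult_lt_0_compat; lra|].
  rewrite <- Hfact in Hle1, Heq1. rewrite <- Hfact' in Hle2, Heq2.
  split; [repeat split|split; [|split; [|split]]].
  - apply Hle1, Hlo.
  - apply Hle2. lra.
  - lra.
  - lra.
  - rewrite <- Hlo1, <- Heq1. split; intros; symmetry; assumption.
  - rewrite <- Hup1, Heq2. split; lra.
  - rewrite <- Hlo1. split; lra.
  - rewrite <- Hup1. split; lra.
Qed.
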